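(* Let $1\le k\le n$, let $A\in\mathbb{R}^{n\times n}$ be symmetric and nonsingular, and let $J\in\mathbb{R}^{k\times k}$ be symmetric with $J^2=I_k$. For $X\in\mathrm{iSt}_{A,J}(k,n)$ and $Z\in T_X\mathrm{iSt}_{A,J}(k,n)$ such that $I_n-\frac12S_{X,Z}A$ is invertible, put $$\mathcal{R}_X^{\mathrm{cay}}(Z)=\left(I_n-\tfrac12S_{X,Z}A\right)^{-1}\left(I_n+\tfrac12S_{X,Z}A\right)X .$$ Then: (i) For each $X\in\mathrm{iSt}_{A,J}(k,n)$, $\mathcal{R}_X^{\mathrm{cay}}$ is well-defined as a map into $\mathrm{iSt}_{A,J}(k,n)$, i.e., $\mathcal{R}_X^{\mathrm{cay}}(Z)\in\mathrm{iSt}_{A,J}(k,n)$ for every $Z\in T_X\mathrm{iSt}_{A,J}(k,n)$ such that $I_n-\frac12S_{X,Z}A$ is invertible. (ii) The map $\mathcal{R}^{\mathrm{cay}}:(X,Z)\mapsto\mathcal{R}_X^{\mathrm{cay}}(Z)$ is a retraction on $\mathrm{iSt}_{A,J}(k,n)$ (on its domain of definition): it is smooth on the set of $(X,Z)$ in the tangent bundle for which $I_n-\frac12S_{X,Z}A$ is invertible, and for all $X\in\mathrm{iSt}_{A,J}(k,n)$ it satisfies $\mathcal{R}_X^{\mathrm{cay}}(0)=X$ and $\left.\frac{\mathrm{d}}{\mathrm{d}t}\mathcal{R}_X^{\mathrm{cay}}(tZ)\right|_{t=0}=Z$ for all $Z\in T_X\mathrm{iSt}_{A,J}(k,n)$.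
   Context: $\mathrm{iSt}_{A,J}(k,n)=\{X\in\mathbb{R}^{n\times k} : X^TAX=J\}$ is the indefinite Stiefel manifold, an embedded submanifold of $\mathbb{R}^{n\times k}$ whenever nonempty, with tangent space $T_X\mathrm{iSt}_{A,J}(k,n)=\{Z\in\mathbb{R}^{n\times k}: Z^TAX+X^TAZ=0\}$. For $X\in\mathrm{iSt}_{A,J}(k,n)$ and $Z\in T_X\mathrm{iSt}_{A,J}(k,n)$, $$S_{X,Z}=XJZ^TAXJX^T-XJZ^T+ZJX^T\in\mathbb{R}^{n\times n}.$$ A retraction on $\mathrm{iSt}_{A,J}(k,n)$ is a smooth map $\mathcal{R}$ from the tangent bundle to $\mathrm{iSt}_{A,J}(k,n)$ whose restriction $\mathcal{R}_X$ to each tangent space satisfies $\mathcal{R}_X(0)=X$ and $\left.\frac{\mathrm{d}}{\mathrm{d}t}\mathcal{R}_X(tZ)\right|_{t=0}=Z$ for all $Z\in T_X\mathrm{iSt}_{A,J}(k,n)$; here the map is only defined where the indicated inverse exists. *)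

(* Defs.v *)
From mathcomp Require Import all_boot all_order all_algebra.
From mathcomp Require Import all_classical all_reals all_analysis.

Set Implicit Arguments.
Unset Strict Implicit.
Unset Printing Implicit Defensive.

Import Order.TTheory GRing.Theory Num.Theory.
Import numFieldNormedType.Exports.

Local Open Scope classical_set_scope.
Local Open Scope ring_scope.

(* To be used with U open and V finite-dimensional: there, continuity of
   x |-> 'd f x v for every v is continuity of x |-> 'd f x in operator norm. *)
Fixpoint Ck_on (R : realType) (V W : normedModType R) (k : nat) (U : set V)
    (f : V -> W) : Prop :=
  match k with
  | 0%N => forall x, U x -> {for x, continuous f}
  | k'.+1 => (forall x, U x -> differentiable f x) /\
             (forall v : V, Ck_on k' U (fun x => 'd f x v))
  end.

Definition smooth_open (R : realType) (V W : normedModType R) (U : set V)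
    (f : V -> W) : Prop :=
  forall k : nat, Ck_on k U f.

(* Smoothness on an arbitrary subset E of V: f agrees locally on E with a
   smooth map defined on an open subset of V. When E is an open subset of an
   embedded submanifold of V and f takes its values in an embedded submanifold
   of W, this is smoothness as a map of manifolds. *)
Definition smooth_on (R : realType) (V W : normedModType R) (E : set V)
    (f : V -> W) : Prop :=
  forall x, E x -> exists (U : set V) (g : V -> W),
    [/\ open U, U x, smooth_open U g & forall y, U y -> E y -> g y = f y].

Definition tangent_bundle (V : Type) (M : set V) (T : V -> set V) :
    set (V * V) :=
  [set p | M p.1 /\ T p.1 p.2].

(* A retraction on M (with tangent spaces T) that is only defined on a subset D
   of the tangent bundle: D has to be an open neighbourhood of the zero section,
   so that the conditions at 0 involve only values of r on D. *)
Definition retraction_on (R : realType) (V : normedModType R) (M : set V)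
    (T : V -> set V) (D : set (V * V)) (r : V -> V -> V) : Prop :=
  [/\ exists2 U : set (V * V), open U & D = tangent_bundle M T `&` U,
      forall X, M X -> D (X, 0),
      forall X Z, D (X, Z) -> M (r X Z),
      smooth_on D (fun p => r p.1 p.2)
    & forall X, M X -> r X 0 = X /\
        forall Z, T X Z -> is_derive (0 : R) (1 : R) (fun t : R => r X (t *: Z)) Z].

Section IndefiniteStiefel.
Context {R : realType} {k n : nat}.
Implicit Types (A : 'M[R]_n) (J : 'M[R]_k) (X Z : 'M[R]_(n, k)).

Definition iSt A J : set 'M[R]_(n, k) := [set X | X^T *m A *m X = J].

Definition iSt_tangent A X : set 'M[R]_(n, k) :=
  [set Z | Z^T *m A *m X + X^T *m A *m Z = 0].

Definition Smx A J X Z : 'M[R]_n :=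
  X *m J *m Z^T *m A *m X *m J *m X^T - X *m J *m Z^T + Z *m J *m X^T.

Definition cay_den A J X Z : 'M[R]_n := 1%:M - 2^-1 *: (Smx A J X Z *m A).

Definition cay A J X Z : 'M[R]_(n, k) :=
  invmx (cay_den A J X Z) *m (1%:M + 2^-1 *: (Smx A J X Z *m A)) *m X.

Definition cay_dom A J : set ('M[R]_(n, k) * 'M[R]_(n, k)) :=
  [set p | tangent_bundle (iSt A J) (iSt_tangent A) p /\
           cay_den A J p.1 p.2 \in unitmx].

End IndefiniteStiefel.

(* Main.v *)
(* With S = S_{X,Z} and M = S A / 2, the tangency condition makes S skew, so
   M^T A = - A M and the Cayley transform (I - M)^-1 (I + M) preserves the form
   A.  Moreover S A X = Z, whence
   R_X(t Z) - X = t (I - t M)^-1 Z whenever I - t M is invertible; dividing by t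
   and letting t tend to 0 gives the derivative.  Smoothness holds because, by
   Cramer's rule, the entries of R_X(Z) are rational functions of those of
   (X, Z), with denominator det (I - M). *)
From HB Require Import structures.
Require Import Defs.
From mathcomp Require Import all_boot all_order all_algebra.
From mathcomp Require Import all_classical all_reals all_analysis.

Import Order.TTheory GRing.Theory Num.Theory.
Import numFieldNormedType.Exports.

Local Open Scope classical_set_scope.
Local Open Scope ring_scope.

Set Implicit Arguments.
Unset Strict Implicit.
Unset Printing Implicit Defensive.

(** The first-order expansion at [x] involves only values near [x], so the one of [f] serves for
    [g]; uniqueness of the differential then identifies the two differentials. *)
Lemma near_eq_differentiable (R : realType) (V W : normedModType R)
    (f g : V -> W) (x : V) :
  (\near x, f x = g x) -> differentiable f x ->
  differentiable g x /\ 'd g x = 'd f x :> (V -> W).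
Proof.
move=> fg df.
have fgx : f x = g x by exact: nbhs_singleton fg.
have dg : continuous ('d f x : V -> W) /\
    g \o shift x = cst (g x) + ('d f x : V -> W) +o_ (0 : V) id.
  split; first exact: diff_continuous.
  have /eqaddoP h := diff_locally df.
  apply/eqaddoP => e e0; have := h e e0.
  have fg0 : \forall y \near (0 : V), f (y + x) = g (y + x).
    by move: fg; rewrite (near_shift 0) subr0.
  apply: filterS2 fg0 => y fgy.
  by rewrite !fctE /= fgy fgx.
have dE : 'd g x = 'd f x :> (V -> W) by apply: diff_unique; case: dg.
by split => //; apply/diff_locallyP; rewrite dE.
Qed.

(** * Closure properties of maps of class $C^k$ on an open set *)

Section Ck_on_theory.
Context {R : realType} {V : normedModType R}.
Implicit Types (W : normedModType R) (U : set V).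

(** Rules for differentials give equalities at points of [U] only, while [Ck_on] takes functions on
    the whole space; this lemma allows the substitution. Openness turns equality on [U] into
    equality near each of its points. *)
Lemma Ck_on_eq W k U (f g : V -> W) : open U ->
  (forall x, U x -> f x = g x) -> Ck_on k U f -> Ck_on k U g.
Proof.
move=> oU; elim: k f g => [|k IH] f g fg /=.
  move=> cf x Ux; rewrite /prop_for /continuous_at -(fg _ Ux).
  apply: cvg_trans (cf x Ux).
  apply: near_eq_cvg; near=> y; apply: fg; near: y.
  exact: open_nbhs_nbhs.
move=> [df dfv].
have dgf x : U x -> differentiable g x /\ 'd g x = 'd f x :> (V -> W).
  move=> Ux; apply: near_eq_differentiable (df x Ux).
  by near=> y; apply: fg; near: y; exact: open_nbhs_nbhs.
split=> [x /dgf[]//|v].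
apply: (IH _ _ _ (dfv v)) => x Ux.
exact: (congr1 (@^~ v) (esym (dgf x Ux).2)).
Unshelve. all: by end_near. Qed.

Lemma Ck_onW W k U (f : V -> W) : Ck_on k.+1 U f -> Ck_on k U f.
Proof.
elim: k f => [|k IH] f /=; first by move=> [df _] x /df/differentiable_continuous.
by move=> [df dfv]; split=> // v; apply: IH; exact: dfv.
Qed.

Lemma Ck_on_cst W k U (w : W) : Ck_on k U (fun=> w).
Proof.
elim: k w => [|k IH] w /=; first by move=> x _; exact: cst_continuous.
split=> [x _|v]; first exact: differentiable_cst.
by under eq_fun do rewrite (diff_cst w); exact: IH.
Qed.

Lemma Ck_on_linear W k U (f : {linear V -> W}) : continuous f -> Ck_on k U f.
Proof.
move=> cf; case: k => [|k] /=; first by move=> x _; exact: cf.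
split=> [x _|v]; first exact: linear_differentiable.
by under eq_fun do rewrite (diff_lin _ cf); exact: Ck_on_cst.
Qed.

Lemma Ck_onD W k U (f g : V -> W) : open U ->
  Ck_on k U f -> Ck_on k U g -> Ck_on k U (fun x => f x + g x).
Proof.
move=> oU; elim: k f g => [|k IH] f g /=.
  by move=> cf cg x Ux; apply: continuousD; [exact: cf|exact: cg].
move=> [df dfv] [dg dgv]; split=> [x Ux|v].
  by apply: differentiableD; [exact: df|exact: dg].
apply: (Ck_on_eq oU _ (IH _ _ (dfv v) (dgv v))) => x Ux.
exact: (congr1 (@^~ v) (esym (diffD (df x Ux) (dg x Ux)))).
Qed.

(** Leibniz rule: $d(fg)(v) = f\,dg(v) + g\,df(v)$, where [f] and [g] themselves enter one order
    lower. *)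
Lemma Ck_onM k U (f g : V -> R) : open U ->
  Ck_on k U f -> Ck_on k U g -> Ck_on k U (fun x => f x * g x).
Proof.
move=> oU; elim: k f g => [|k IH] f g /=.
  by move=> cf cg x Ux; apply: continuousM; [exact: cf|exact: cg].
move=> Cf Cg; have [df dfv] := Cf; have [dg dgv] := Cg; split=> [x Ux|v].
  by apply: differentiableM; [exact: df|exact: dg].
apply: (Ck_on_eq oU _ (Ck_onD oU (IH _ _ (Ck_onW Cf) (dgv v))
  (IH _ _ (Ck_onW Cg) (dfv v)))) => x Ux.
exact: (congr1 (@^~ v) (esym (diffM (df x Ux) (dg x Ux)))).
Qed.

Lemma Ck_onZl W k U (f : V -> R) (w : W) : open U ->
  Ck_on k U f -> Ck_on k U (fun x => f x *: w).
Proof.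
move=> oU; elim: k f => [|k IH] f /=.
  by move=> cf x Ux; apply: continuousZr_tmp; exact: cf.
move=> [df dfv]; split=> [x Ux|v]; first exact/differentiableZl/df.
apply: (Ck_on_eq oU _ (IH _ (dfv v))) => x Ux.
exact: (congr1 (@^~ v) (esym (diffZl _ (df x Ux)))).
Qed.

(** Induction with [f] fixed: $d(1/f)(v) = -(1/f)^2\,df(v)$ involves $1/f$ one order lower, which
    the induction hypothesis provides. *)
Lemma Ck_onV k U (f : V -> R) : open U -> (forall x, U x -> f x != 0) ->
  Ck_on k U f -> Ck_on k U (fun x => (f x)^-1).
Proof.
move=> oU f0; elim: k => [|k IH] /=.
  by move=> cf x Ux; apply: continuousV; [exact: f0|exact: cf].
move=> Cf; have [df dfv] := Cf; split=> [x Ux|v].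
  by apply: differentiableV; [exact: df|exact: f0].
have Cfi := IH (Ck_onW Cf).
have Cd := Ck_onM oU (Ck_onM oU (Ck_on_cst k U (-1 : R)) (Ck_onM oU Cfi Cfi)) (dfv v).
apply: (Ck_on_eq oU _ Cd) => x Ux.
have /(congr1 (@^~ v)) /= dV := diffV (df x Ux) (f0 x Ux).
by rewrite mulN1r -expr2 exprVn; exact: esym dV.
Qed.

Lemma Ck_on_sum W k U (I : Type) (r : seq I) (P : pred I) (f : I -> V -> W) :
  open U -> (forall i, P i -> Ck_on k U (f i)) ->
  Ck_on k U (fun x => \sum_(i <- r | P i) f i x).
Proof.
move=> oU Cf; elim: r => [|i r IH].
  by under eq_fun do rewrite big_nil; exact: Ck_on_cst.
have [Pi|/negbTE Pi] := boolP (P i); under eq_fun do rewrite big_cons Pi.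
  by apply: Ck_onD => //; exact: Cf.
exact: IH.
Qed.

Lemma Ck_on_prod k U (I : Type) (r : seq I) (P : pred I) (f : I -> V -> R) :
  open U -> (forall i, P i -> Ck_on k U (f i)) ->
  Ck_on k U (fun x => \prod_(i <- r | P i) f i x).
Proof.
move=> oU Cf; elim: r => [|i r IH].
  by under eq_fun do rewrite big_nil; exact: Ck_on_cst.
have [Pi|/negbTE Pi] := boolP (P i); under eq_fun do rewrite big_cons Pi.
  by apply: Ck_onM => //; exact: Cf.
exact: IH.
Qed.

(** * Matrix-valued maps, entry by entry *)

Definition Ck_entries {m n} k U (F : V -> 'M[R]_(m, n)) :=
  forall i j, Ck_on k U (fun x => F x i j).

(** A matrix is the finite sum of its entries times constant elementary matrices, so scalar maps
    suffice. *)
Lemma Ck_entries_on m n k U (F : V -> 'M[R]_(m, n)) : open U ->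
  Ck_entries k U F -> Ck_on k U F.
Proof.
move=> oU CF.
have -> : F = fun x => \sum_i \sum_j F x i j *: delta_mx i j.
  by apply/funext => x; exact: matrix_sum_delta.
by do 2![apply: Ck_on_sum => // ? _]; exact: Ck_onZl.
Qed.

Lemma Ck_entries_cst m n k U (M : 'M[R]_(m, n)) : Ck_entries k U (fun=> M).
Proof. by move=> i j; exact: Ck_on_cst. Qed.

Lemma Ck_entries_linear m n k U (F : {linear V -> 'M[R]_(m, n)}) :
  continuous F -> Ck_entries k U F.
Proof.
move=> cF i j; have Flin : linear (fun x => F x i j).
  by move=> a u v; rewrite linearP !mxE.
pose FM := GRing.isLinear.Build _ _ _ _ _ Flin.
pose FL : {linear V -> R} := HB.pack (fun x => F x i j) FM.
apply: (Ck_on_linear _ _ (f := FL)) => x.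
exact: continuous_comp (cF x) (@coord_continuous _ _ _ i j (F x)).
Qed.

Lemma Ck_entriesD m n k U (F G : V -> 'M[R]_(m, n)) : open U ->
  Ck_entries k U F -> Ck_entries k U G -> Ck_entries k U (fun x => F x + G x).
Proof.
by move=> oU CF CG i j; under eq_fun do rewrite mxE; exact: Ck_onD.
Qed.

Lemma Ck_entriesZ m n k U (f : V -> R) (F : V -> 'M[R]_(m, n)) : open U ->
  Ck_on k U f -> Ck_entries k U F -> Ck_entries k U (fun x => f x *: F x).
Proof.
by move=> oU Cf CF i j; under eq_fun do rewrite mxE; exact: Ck_onM.
Qed.

Lemma Ck_entriesN m n k U (F : V -> 'M[R]_(m, n)) : open U ->
  Ck_entries k U F -> Ck_entries k U (fun x => - F x).
Proof.
move=> oU CF; under eq_fun do rewrite -scaleN1r.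
by apply: Ck_entriesZ => //; exact: Ck_on_cst.
Qed.

Lemma Ck_entries_tr m n k U (F : V -> 'M[R]_(m, n)) :
  Ck_entries k U F -> Ck_entries k U (fun x => (F x)^T).
Proof. by move=> CF i j; under eq_fun do rewrite mxE; exact: CF. Qed.

Lemma Ck_entriesM m n p k U (F : V -> 'M[R]_(m, n)) (G : V -> 'M[R]_(n, p)) :
  open U -> Ck_entries k U F -> Ck_entries k U G ->
  Ck_entries k U (fun x => F x *m G x).
Proof.
move=> oU CF CG i j; under eq_fun do rewrite mxE.
by apply: Ck_on_sum => // l _; exact: Ck_onM.
Qed.

Lemma Ck_on_det n k U (F : V -> 'M[R]_n) : open U ->
  Ck_entries k U F -> Ck_on k U (fun x => \det (F x)).
Proof.
(* The determinant unfolds to the sum over permutations of signed products of entries. *)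
move=> oU CF; apply: Ck_on_sum => // s _; apply: Ck_onM => //.
  exact: Ck_on_cst.
by apply: Ck_on_prod => // i _; exact: CF.
Qed.

Lemma Ck_entries_invmx n k U (F : V -> 'M[R]_n) : open U ->
  (forall x, U x -> F x \in unitmx) ->
  Ck_entries k U F -> Ck_entries k U (fun x => invmx (F x)).
Proof.
move=> oU uF CF i j.
(* Off the units [invmx] returns its argument, so Cramer's formula replaces it on [U] only. *)
apply: (@Ck_on_eq _ _ _ (fun x => (\det (F x))^-1 * \adj (F x) i j)) => //.
  by move=> x /uF uFx; rewrite /invmx uFx [RHS]mxE.
apply: Ck_onM => //.
  apply: Ck_onV => //; last exact: Ck_on_det.
  by move=> x /uF; rewrite unitmxE unitfE.
under eq_fun do rewrite mxE /cofactor.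
apply: Ck_onM => //; first exact: Ck_on_cst.
by apply: Ck_on_det => // r s; under eq_fun do rewrite !mxE; exact: CF.
Qed.

Lemma open_unitmx n (F : V -> 'M[R]_n) :
  Ck_entries 0 setT F -> open [set x | F x \in unitmx].
Proof.
move=> CF.
have -> : [set x | F x \in unitmx] =
    (fun x => \det (F x)) @^-1` [set y | y != 0].
  by apply/seteqP; split=> x /=; rewrite unitmxE unitfE.
apply: open_comp; last exact: open_neq.
by move=> x _; exact: (Ck_on_det openT CF).
Qed.

End Ck_on_theory.

(** * Algebra of $S_{X,Z}$ and of the Cayley transform *)

Section Cayley.
Context {R : realType} {k n : nat} {A : 'M[R]_n} {J : 'M[R]_k}.
Hypotheses (Asym : A^T = A) (Jsym : J^T = J).
Implicit Types X Z : 'M[R]_(n, k).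

(** Tangency makes $Z^TAX$ skew, hence also the first term $XJ(Z^TAX)JX^T$; transposition exchanges
    the other two terms up to sign. *)
Lemma Smx_skew X Z : iSt_tangent A X Z -> (Smx A J X Z)^T = - Smx A J X Z.
Proof.
move=> /= /eqP; rewrite addr_eq0 => /eqP tZ.
have e : (X *m J *m Z^T *m A *m X *m J *m X^T)^T =
    - (X *m J *m Z^T *m A *m X *m J *m X^T).
  have -> : X *m J *m Z^T *m A *m X *m J *m X^T =
      X *m J *m (Z^T *m A *m X) *m J *m X^T by rewrite !mulmxA.
  rewrite !trmx_mul !trmxK Asym Jsym [in RHS]tZ.
  by rewrite !(mulmxN, mulNmx) opprK !mulmxA.
rewrite /Smx raddfD raddfB /= e !trmx_mul !trmxK Jsym !mulmxA.
by rewrite !opprD opprK addrAC.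
Qed.

Lemma SmxZ X (t : R) Z : Smx A J X (t *: Z) = t *: Smx A J X Z.
Proof.
by rewrite /Smx linearZ /= -!(scalemxAl, scalemxAr) scalerDr scalerBr.
Qed.

(** Since $JX^TAX = J^2 = I$, multiplication by $AX$ strips a right factor $JX^T$: the first two
    terms of $S$ then cancel and the third leaves $Z$. *)
Lemma Smx_mulX X Z : J *m J = 1%:M -> iSt A J X -> Smx A J X Z *m A *m X = Z.
Proof.
move=> JJ XAX.
have e (B : 'M[R]_(n, k)) : B *m J *m X^T *m A *m X = B.
  by rewrite -!mulmxA (mulmxA X^T) XAX JJ mulmx1.
by rewrite /Smx !mulmxDl !mulNmx !e subrr add0r.
Qed.

Lemma cay_iSt X Z : iSt A J X -> iSt_tangent A X Z ->
  cay_den A J X Z \in unitmx -> iSt A J (cay A J X Z).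
Proof.
move=> XAX tZ; rewrite /cay /cay_den /iSt /=; set M := _ *: _ => uM.
have MA : M^T *m A = - (A *m M).
  rewrite /M linearZ /= trmx_mul Asym Smx_skew // -scalemxAl -scalemxAr.
  by rewrite mulmxN mulNmx scalerN mulmxA.
set P := 1%:M - M in uM *; set Q := 1%:M + M.
have PQ : P *m Q = Q *m P.
  by rewrite /P mulmxBl mulmxBr mul1mx mulmx1 /Q mulmxDr mulmxDl mulmx1 mul1mx.
have QA : Q^T *m A = A *m P.
  by rewrite /Q /P linearD /= trmx1 mulmxDl MA mul1mx mulmxBr mulmx1.
have PA : P^T *m A = A *m Q.
  by rewrite /Q /P linearB /= trmx1 mulmxBl MA opprK mul1mx mulmxDr mulmx1.
have CAC : (invmx P *m Q)^T *m A *m (invmx P *m Q) = A.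
  (* Only the transposed factor becomes $QP^{-1}$; then $P^{-T}Q^TAP^{-1}Q = P^{-T}APP^{-1}Q =
     P^{-T}AQ = P^{-T}P^TA = A$. *)
  have {1}-> : invmx P *m Q = Q *m invmx P.
    by apply: (canLR (mulKmx uM)); rewrite mulmxA PQ mulmxK.
  rewrite trmx_mul -(mulmxA _ Q^T) QA !mulmxA -(mulmxA _ P) mulmxV // mulmx1.
  by rewrite -(mulmxA _ A) -PA trmx_inv mulKmx // unitmx_tr.
by rewrite trmx_mul -XAX -[in RHS]CAC !mulmxA.
Qed.

Lemma cay_den0 X : cay_den A J X 0 = 1%:M.
Proof.
(* The zero vector is written [0 *: 0], so that homogeneity yields $S_{X,0} = 0$. *)
by rewrite /cay_den -(scale0r (0 : 'M[R]_(n, k))) SmxZ scale0r mul0mx scaler0 subr0.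
Qed.

Lemma cay0 X : cay A J X 0 = X.
Proof.
rewrite /cay cay_den0 -(scale0r (0 : 'M[R]_(n, k))) SmxZ scale0r mul0mx scaler0.
by rewrite addr0 invmx1 !mul1mx.
Qed.

Lemma cayB X (t : R) Z : J *m J = 1%:M -> iSt A J X ->
  cay_den A J X (t *: Z) \in unitmx ->
  cay A J X (t *: Z) - X = t *: (invmx (cay_den A J X (t *: Z)) *m Z).
Proof.
rewrite /cay /cay_den SmxZ; set M := 2^-1 *: _ => JJ XAX uD.
(* Here [M] contains $t$. Multiplying by $I-M$ turns the left side into $(I+M)X-(I-M)X = 2MX = tSAX
   = tZ$. *)
apply: (can_inj (mulKmx uD)).
rewrite -scalemxAr mulKVmx // mulmxBr -!mulmxA mulKVmx // -mulmxBl.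
rewrite opprB [M - _]addrC addrACA subrr add0r /M -scalerDl -div1r -splitr.
by rewrite scale1r -!scalemxAl Smx_mulX.
Qed.

(** * Smooth dependence of the Cayley map on parameters *)

Section Smooth.
Context {V : normedModType R} (m : nat) (U : set V).
Variables X Z : V -> 'M[R]_(n, k).
Hypotheses (oU : open U) (CX : Ck_entries m U X) (CZ : Ck_entries m U Z).

Lemma Ck_entries_SmxA : Ck_entries m U (fun x => Smx A J (X x) (Z x) *m A).
Proof.
have CXT := Ck_entries_tr CX; have CZT := Ck_entries_tr CZ.
by repeat first [ exact: CX | exact: CZ | exact: CXT | exact: CZT | exact: oU
  | exact: Ck_entries_cst | apply: Ck_entriesM | apply: Ck_entriesD
  | apply: Ck_entriesN ].
Qed.

(** Keeping [X] and [Z] as functions of a parameter covers both the line $t \mapsto (X, tZ)$ and the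
    two projections of a pair. *)
Lemma Ck_entries_cay_den : Ck_entries m U (fun x => cay_den A J (X x) (Z x)).
Proof.
apply: Ck_entriesD => //; first exact: Ck_entries_cst.
apply: Ck_entriesN => //; apply: Ck_entriesZ => //; first exact: Ck_on_cst.
exact: Ck_entries_SmxA.
Qed.

Lemma Ck_entries_cay : (forall x, U x -> cay_den A J (X x) (Z x) \in unitmx) ->
  Ck_entries m U (fun x => cay A J (X x) (Z x)).
Proof.
move=> uD; do 2![apply: Ck_entriesM => //].
  by apply: Ck_entries_invmx => //; exact: Ck_entries_cay_den.
apply: Ck_entriesD => //; first exact: Ck_entries_cst.
apply: Ck_entriesZ => //; first exact: Ck_on_cst.
exact: Ck_entries_SmxA.
Qed.

End Smooth.

Lemma is_derive_cay X Z : J *m J = 1%:M -> iSt A J X ->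
  is_derive (0 : R) (1 : R) (fun t : R => cay A J X (t *: Z)) Z.
Proof.
move=> JJ XAX.
have CX r U : Ck_entries r U (fun _ : R => X) by exact: Ck_entries_cst.
have CZ r U : open U -> Ck_entries r U (fun t : R => t *: Z).
  move=> oU; apply: Ck_entriesZ => //; last exact: Ck_entries_cst.
  by apply: (@Ck_on_linear _ _ _ _ _ idfun) => x.
have CD r U (oU : open U) := Ck_entries_cay_den oU (CX r U) (CZ r U oU).
pose U := [set t : R | cay_den A J X (t *: Z) \in unitmx].
have oU : open U by apply: open_unitmx; apply: CD; exact: openT.
have U0 : U 0 by rewrite /U /= scale0r cay_den0 unitmx1.
(* Order 0 is plain continuity: the map takes the value $Z$ at $0$, and it will be the difference
   quotient. *)
have CI : Ck_on 0 U (fun t : R => invmx (cay_den A J X (t *: Z)) *m Z).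
  apply: Ck_entries_on => //; apply: Ck_entriesM => //.
    by apply: Ck_entries_invmx => //; exact: CD.
  exact: Ck_entries_cst.
have lim_quot : h^-1 *: (((fun t : R => cay A J X (t *: Z)) \o shift 0)
    (h *: (1 : R)) - cay A J X (0 *: Z)) @[h --> 0^'] --> Z.
  have := CI 0 U0.
  rewrite /prop_for /continuous_at scale0r cay_den0 invmx1 mul1mx => lim_inv.
  have : invmx (cay_den A J X (h *: Z)) *m Z @[h --> 0^'] --> Z.
    exact: cvg_trans (cvg_app _ (@nbhs_dnbhs _ _)) lim_inv.
  (* For small nonzero $h$ the denominator is invertible, so [cayB] applies and the factor $h$
     cancels. *)
  apply: cvg_trans; apply: near_eq_cvg; near=> h.
  have h0 : h != 0 by near: h; exact: nbhs_dnbhs_neq.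
  have Uh : U h by near: h; apply: nbhs_dnbhs; exact: open_nbhs_nbhs.
  by rewrite /= addr0 [h *: 1]mulr1 cay0 (cayB JJ XAX Uh) (scalerK h0).
by apply: DeriveDef; [exact: cvgP lim_quot|exact: cvg_lim lim_quot].
Unshelve. all: by end_near. Qed.

End Cayley.

(** * Verification of the retraction conditions *)

Unset Implicit Arguments.

Theorem proposition4p2 (R : realType) (k n : nat) (hk : (1 <= k)%N)
    (hkn : (k <= n)%N) (A : 'M[R]_n) (J : 'M[R]_k)
    (Asym : A^T = A) (Anonsing : A \in unitmx)
    (Jsym : J^T = J) (Jinv : J *m J = 1%:M) :
  (forall X : 'M[R]_(n, k), iSt A J X ->
    forall Z : 'M[R]_(n, k), iSt_tangent A X Z ->
      cay_den A J X Z \in unitmx -> iSt A J (cay A J X Z)) /\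
  retraction_on (iSt A J) (iSt_tangent A) (cay_dom A J) (cay A J).
Proof.
split; first by move=> X ? Z; exact: cay_iSt.
pose V : normedModType R := ('M[R]_(n, k) * 'M[R]_(n, k))%type.
(* Invertibility is imposed on all pairs, tangent or not, which makes [U] open in the ambient space;
   intersecting it with the tangent bundle gives the domain. *)
pose U : set V := [set p | cay_den A J p.1 p.2 \in unitmx].
have C1 r (W : set V) : Ck_entries r W (fun p : V => p.1).
  by apply: (Ck_entries_linear _ _ (F := fst)) => p; exact: cvg_fst.
have C2 r (W : set V) : Ck_entries r W (fun p : V => p.2).
  by apply: (Ck_entries_linear _ _ (F := snd)) => p; exact: cvg_snd.
have oU : open U.
  exact: open_unitmx (Ck_entries_cay_den openT (C1 0 setT) (C2 0 setT)).
split.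
- by exists U.
- move=> X XAX; split=> /=; last by rewrite cay_den0 unitmx1.
  by split=> //=; rewrite /iSt_tangent /= trmx0 !mul0mx mulmx0 addr0.
- by move=> X Z [[/= ? ?] ?]; exact: cay_iSt.
(* The formula is smooth on all of [U], so [cay] is its own extension around every point. *)
- move=> p [_ Up]; exists U, (fun p => cay A J p.1 p.2); split=> // r.
  apply: Ck_entries_on => //; exact: (Ck_entries_cay oU (C1 r U) (C2 r U)).
- by move=> X XAX; split=> [|Z _]; [exact: cay0|exact: is_derive_cay].
Qed.
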